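(* Let $k\geqslant 2$, let $G$ be a $k$-player projection game, and let $\varepsilon>0$ with $\mathbf{val}(G)=1-\varepsilon$. Then there is a constant $c>0$, depending only on $\varepsilon$ and $G$, such that $\mathbf{val}(G^{\otimes n})\leqslant \exp(-c\,n)$ for every $n\geqslant 1$.
   Context: A $k$-player game $G$ consists of finite question sets $\mathcal{X}_1,\dots,\mathcal{X}_k$, finite answer sets $\mathcal{A}_1,\dots,\mathcal{A}_k$, a probability distribution $\mu$ on $\mathcal{X}_1\times\cdots\times\mathcal{X}_k$, and a predicate $V:(\mathcal{X}_1\times\cdots\times\mathcal{X}_k)\times(\mathcal{A}_1\times\cdots\times\mathcal{A}_k)\to\{0,1\}$. The verifier samples $(x^1,\dots,x^k)\sim\mu$, sends $x^i$ to player $i$, player $i$ answers $a^i=\alpha^i(x^i)$ for a function $\alpha^i:\mathcal{X}_i\to\mathcal{A}_i$ (no communication), and the verifier accepts iff $V((x^1,\dots,x^k),(a^1,\dots,a^k))=1$. The value $\mathbf{val}(G)$ is the maximum over strategies $(\alpha^1,\dots,\alpha^k)$ of the acceptance probability. The $n$-fold parallel repetition $G^{\otimes n}$ is the $k$-player game with question sets $\mathcal{X}_i^n$ and answer sets $\mathcal{A}_i^n$ in which the $n$ question tuples $(x^1_j,\dots,x^k_j)$, $j\in[n]$, are sampled independently from $\mu$, player $i$ receives $(x^i_1,\dots,x^i_n)$ and answers $(a^i_1,\dots,a^i_n)$, and the verifier accepts iff $V((x^1_j,\dots,x^k_j),(a^1_j,\dots,a^k_j))=1$ for all $j\in[n]$.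 $G$ is a projection game if for every question tuple $q=(x^1,\dots,x^k)$ there exist an integer $D_q\geqslant 1$ and maps $\sigma^i_q:\mathcal{A}_i\to[D_q]$, $i\in[k]$, such that $V(q,(a^1,\dots,a^k))=1$ iff $\sigma^i_q(a^i)=\sigma^{i'}_q(a^{i'})$ for all $i\neq i'$. *)

(* Defs.v *)
From HB Require Import structures.
From mathcomp Require Import all_boot all_order all_algebra.
From mathcomp Require Import reals sequences exp.
Set Implicit Arguments. Unset Strict Implicit. Unset Printing Implicit Defensive.
Import Order.TTheory GRing.Theory Num.Theory.
Local Open Scope ring_scope.

Record game (R : numDomainType) (k : nat) := Game {
  Xq : 'I_k -> finType;
  Aa : 'I_k -> finType;
  mu : {dffun forall i : 'I_k, Xq i} -> R;
  V  : {dffun forall i : 'I_k, Xq i} -> {dffun forall i : 'I_k, Aa i} -> bool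
}.

Arguments Xq {R k} g i : rename.
Arguments Aa {R k} g i : rename.
Arguments mu {R k} g _ : rename.
Arguments V {R k} g _ _ : rename.

Section Games.
Variables (R : numDomainType) (k : nat).

Definition qtuple (G : game R k) := {dffun forall i : 'I_k, Xq G i}.
Definition atuple (G : game R k) := {dffun forall i : 'I_k, Aa G i}.

Definition is_dist (G : game R k) : Prop :=
  (forall q : qtuple G, 0 <= mu G q) /\ \sum_(q : qtuple G) mu G q = 1.

Definition strategy (G : game R k) := {dffun forall i : 'I_k, {ffun Xq G i -> Aa G i}}.

Definition answers (G : game R k) (s : strategy G) (q : qtuple G) : atuple G :=
  [ffun i => s i (q i)].

Definition win_prob (G : game R k) (s : strategy G) : R :=
  \sum_(q : qtuple G) mu G q * (V G q (answers s q))%:R.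

Definition game_val (G : game R k) : R := \big[Num.max/0]_(s : strategy G) win_prob s.

Definition rep_Xq (G : game R k) (n : nat) (i : 'I_k) : finType :=
  {ffun 'I_n -> Xq G i}.
Definition rep_Aa (G : game R k) (n : nat) (i : 'I_k) : finType :=
  {ffun 'I_n -> Aa G i}.

Definition coord_q (G : game R k) (n : nat)
  (q : {dffun forall i : 'I_k, rep_Xq G n i}) (j : 'I_n) : qtuple G :=
  [ffun i => q i j].
Definition coord_a (G : game R k) (n : nat)
  (a : {dffun forall i : 'I_k, rep_Aa G n i}) (j : 'I_n) : atuple G :=
  [ffun i => a i j].

Definition rep (G : game R k) (n : nat) : game R k :=
  @Game R k (rep_Xq G n) (rep_Aa G n)
    (fun q => \prod_(j < n) mu G (coord_q q j))
    (fun q a => [forall j : 'I_n, V G (coord_q q j) (coord_a a j)]).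

Definition projection_game (G : game R k) : Prop :=
  forall q : qtuple G, exists D : nat, (1 <= D)%N /\
    exists sigma : forall i : 'I_k, Aa G i -> 'I_D,
      forall a : atuple G,
        V G q a <-> (forall i i' : 'I_k, i != i' -> sigma i (a i) = sigma i' (a i')).

End Games.

(* Main.v *)
Require Import Defs.
From HB Require Import structures.
From mathcomp Require Import all_boot all_order all_algebra.
From mathcomp Require Import reals sequences exp.
From mathcomp Require Import ring lra.
Import Order.TTheory GRing.Theory Num.Theory.
Local Open Scope ring_scope.
Set Implicit Arguments. Unset Strict Implicit. Unset Printing Implicit Defensive.

(** Add a referee player who sees the whole question tuple and answers like player [i0].
  Two rounds that share player [i]'s question can be combined into one round: the
  players in [S] get their question from the first round, the others from the second,
  and the verifier accepts when the given answers extend to winning answers of both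
  rounds that agree for [i]. By Cauchy-Schwarz the n-fold success probability of the new
  game is at least the square of the old one, for the same strategy. Two copies of the
  same round combine into the projection predicate of that round, because answers
  winning twice and agreeing for [i] have the same label twice; so the original
  constraints never get lost. Repeating this until the set of question tuples stops
  growing makes it closed under mixing, and as there are at least three players it is
  then a disjoint union of boxes. If every box had a perfect strategy, so would [G];
  hence some box has none.

  It remains to treat a game with uniform questions in a box and without perfect
  strategy, tested on a set [J] of rounds. On a product set [D] of question sequences
  that is not exponentially small, some round of [J] has all its questions in
  non-negligible proportion; the plurality answers of that round form a strategy, which
  fails somewhere, so a constant fraction of [D] loses there. Splitting [D] by the
  questions and answers of this round and iterating gives exponential decay. *)

(** * Sums of products over sequences of rounds *)

Section ProductSums.
Variables (R : comPzRingType) (n : nat).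

Lemma sum_prod_fiber (T Z : finType) (c : 'I_n -> T -> R) (f : 'I_n -> T -> Z)
    (w : {ffun 'I_n -> Z}) :
  \sum_(o : {ffun 'I_n -> T} | [ffun j => f j (o j)] == w) \prod_j c j (o j) =
  \prod_j \sum_(x | f j x == w j) c j x.
Proof.
rewrite bigA_distr_big_dep; apply: eq_bigl => o.
apply/eqP/familyP => [<- j|fw]; first by rewrite unfold_in /= ffunE.
by apply/ffunP => j; rewrite ffunE; apply/eqP; have := fw j.
Qed.

(** The factor [c] may look at the whole image sequence, as a reply depends on a player's questions
    in all rounds; once that sequence is fixed to [w], the rounds separate. *)
Lemma sum_prod_push (T Z : finType) (f : T -> Z) (c : 'I_n -> T -> {ffun 'I_n -> Z} -> R) :
  \sum_(o : {ffun 'I_n -> T}) \prod_j c j (o j) [ffun k => f (o k)] =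
  \sum_(w : {ffun 'I_n -> Z}) \prod_j \sum_(x | f x == w j) c j x w.
Proof.
rewrite (partition_big (fun o : {ffun 'I_n -> T} => [ffun j => f (o j)]) xpredT) //=.
apply: eq_bigr => w _; rewrite -(sum_prod_fiber (fun j x => c j x w) (fun=> f)).
by apply: eq_bigr => o /eqP->.
Qed.

Lemma sum_pair (T U : finType) (F : T * U -> R) :
  \sum_x F x = \sum_a \sum_b F (a, b).
Proof. by rewrite pair_big; apply: eq_bigr => -[]. Qed.

Lemma sum_ffun_pair (T U : finType) (F : {ffun 'I_n -> T * U} -> R) :
  \sum_o F o =
  \sum_(a : {ffun 'I_n -> T}) \sum_(b : {ffun 'I_n -> U}) F [ffun j => (a j, b j)].
Proof.
rewrite pair_big /=.
rewrite (reindex (fun ab : {ffun 'I_n -> T} * {ffun 'I_n -> U} =>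
  [ffun j => (ab.1 j, ab.2 j)])) //=.
exists (fun o => ([ffun j => (o j).1], [ffun j => (o j).2])).
  by move=> [a b] _ /=; congr pair; apply/ffunP => j; rewrite !ffunE.
by move=> o _; apply/ffunP => j; rewrite !ffunE /=; case: (o j).
Qed.

Lemma sum_prod_cst (T : finType) (c : T -> R) :
  \sum_(o : {ffun 'I_n -> T}) \prod_j c (o j) = (\sum_x c x) ^+ n.
Proof. by rewrite -(bigA_distr_bigA (fun (_ : 'I_n) x => c x)) prodr_const card_ord. Qed.

End ProductSums.

Definition row {P : finType} {X : P -> finType} {n : nat}
    (s : {dffun forall p, {ffun 'I_n -> X p}}) (j : 'I_n) :
    {dffun forall p, X p} :=
  [ffun p => s p j].

Definition col {P : finType} {X : P -> finType} {n : nat}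
    (z : {ffun 'I_n -> {dffun forall p, X p}}) :
    {dffun forall p, {ffun 'I_n -> X p}} :=
  [ffun p => [ffun j => z j p]].

Lemma sum_rows (R : pzRingType) (P : finType) (X : P -> finType) (n : nat)
    (F : {ffun 'I_n -> {dffun forall p, X p}} -> R) :
  \sum_z F z = \sum_s F [ffun j => row s j].
Proof.
rewrite (reindex (fun s : {dffun forall p, {ffun 'I_n -> X p}} =>
  [ffun j => row s j])) //=.
exists col => [s _|z _].
  by apply/ffunP => p; apply/ffunP => j; rewrite !ffunE.
by apply/ffunP => j; apply/ffunP => p; rewrite !ffunE.
Qed.

Definition mix {P : finType} {X : P -> finType} (S : {set P})
    (q q' : {dffun forall p, X p}) : {dffun forall p, X p} :=
  [ffun p => if p \in S then q p else q' p].

Lemma mix_id (P : finType) (X : P -> finType) (S : {set P}) (q : {dffun forall p, X p}) :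
  mix S q q = q.
Proof. by apply/ffunP => p; rewrite ffunE if_same. Qed.

(** * Games with verifier coins and their squares *)

Section VGames.
Variables (R : realType) (P : finType) (X A : P -> finType).

Let tupX := {dffun forall p, X p}.
Let tupA := {dffun forall p, A p}.

(** Squaring produces coins that ask the same tuple but judge the answers differently, so the
    predicate is attached to the coin and not to the questions. *)
Record vgame := VGame {
  coin : finType;
  wt : coin -> R;
  ask : coin -> tupX;
  acc : coin -> tupA -> bool
}.

Arguments wt G o : rename, clear implicits.
Arguments ask G o : rename, clear implicits.
Arguments acc G o a : rename, clear implicits.

Definition vdist (G : vgame) := (forall o, 0 <= wt G o) /\ \sum_o wt G o = 1.

Definition reply {n : nat} (al : forall p, {ffun 'I_n -> X p} -> {ffun 'I_n -> A p})
    (s : {dffun forall p, {ffun 'I_n -> X p}}) (j : 'I_n) : tupA :=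
  [ffun p => al p (s p) j].

Definition asks {n : nat} (G : vgame) (w : {ffun 'I_n -> coin G}) :=
  col [ffun j => ask G (w j)].

Definition winp (n : nat) (G : vgame)
    (al : forall p, {ffun 'I_n -> X p} -> {ffun 'I_n -> A p}) : R :=
  \sum_(w : {ffun 'I_n -> coin G})
    \prod_j (wt G (w j) * (acc G (w j) (reply al (asks w) j))%:R).

Definition marg (G : vgame) (i : P) (x : X i) : R :=
  \sum_(o | ask G o i == x) wt G o.

(** The second coin follows [wt G] conditioned on asking player [i] the same question as the first.
    Players and alphabets stay the same, so a strategy for [G] can be played unchanged. *)
Definition square (i : P) (S : {set P}) (G : vgame) : vgame := {|
  coin := (coin G * coin G)%type;
  wt := fun o => if ask G o.2 i == ask G o.1 i
                 then wt G o.1 * wt G o.2 / marg G (ask G o.1 i) else 0;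
  ask := fun o => mix S (ask G o.1) (ask G o.2);
  acc := fun o a => [exists b : tupA, exists b' : tupA,
           [&& acc G o.1 b, acc G o.2 b', b i == b' i & a == mix S b b']]
|}.

Lemma marg_ge0 G i (x : X i) : vdist G -> 0 <= marg G x.
Proof. by case=> w0 _; apply: sumr_ge0. Qed.

Lemma marg_gt0 G i o : vdist G -> 0 < wt G o -> 0 < marg G (ask G o i).
Proof.
case=> w0 _ wo; rewrite /marg (bigD1 o) //=.
by rewrite ltr_pwDl // sumr_ge0.
Qed.

Lemma square_dist i S G : vdist G -> vdist (square i S G).
Proof.
move=> dG; have [w0 w1] := dG; split=> [[o o']|] /=.
  by case: ifP => // _; rewrite divr_ge0 ?mulr_ge0 ?marg_ge0.
rewrite -(pair_big xpredT xpredT (fun o o' => if ask G o' i == ask G o i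
  then wt G o * wt G o' / marg G (ask G o i) else 0)) /=.
rewrite -w1; apply: eq_bigr => o _.
rewrite -big_mkcond /= -big_distrl /= -big_distrr /= -/(marg G (ask G o i)).
have [m0|m0] := eqVneq (marg G (ask G o i)) 0; last by rewrite mulfK.
have := w0 o; rewrite le_eqVlt => /orP[/eqP<-|/(marg_gt0 i dG)]; first by rewrite !mul0r.
by rewrite m0 ltxx.
Qed.

(* The two runs share player i's questions [x], so Cauchy-Schwarz over [x] applies
   with the probability weights [N x]. *)
Lemma winp_square n i S G (al : forall p, {ffun 'I_n -> X p} -> {ffun 'I_n -> A p}) :
  vdist G -> winp G al ^+ 2 <= winp (square i S G) al.
Proof.
move=> dG; have [w0 w1] := dG.
pose g (w : {ffun 'I_n -> coin G}) := \prod_j (wt G (w j) * (acc G (w j) (reply al (asks w) j))%:R).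
pose h (w : {ffun 'I_n -> coin G}) := \prod_j wt G (w j).
have g0 w : 0 <= g w by apply: prodr_ge0 => j _; rewrite mulr_ge0.
have gh w : g w <= h w.
  apply: ler_prod => j _; rewrite mulr_ge0 //=.
  by case: acc; rewrite ?mulr1 ?mulr0.
pose x (w : {ffun 'I_n -> coin G}) := asks w i.
have xE w : x w = [ffun j => ask G (w j) i].
  by rewrite /x /asks /col ffunE; apply/ffunP => j; rewrite !ffunE.
pose T (y : {ffun 'I_n -> X i}) := \sum_(w | x w == y) g w.
pose N (y : {ffun 'I_n -> X i}) := \sum_(w | x w == y) h w.
have T0 y : 0 <= T y by apply: sumr_ge0.
have TN y : T y <= N y by apply: ler_sum.
have NE y : N y = \prod_j marg G (y j).
  rewrite /marg -(sum_prod_fiber (fun _ => wt G) (fun _ o => ask G o i)).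
  by apply: eq_bigl => w; rewrite xE.
have sT : winp G al = \sum_y T y by rewrite /winp (partition_big x xpredT).
have sN : \sum_y N y = 1.
  transitivity (\sum_w h w); first by rewrite [RHS](partition_big x xpredT).
  by rewrite /h sum_prod_cst w1 expr1n.
have CS : winp G al ^+ 2 <= \sum_y T y ^+ 2 / N y.
  set s := winp G al.
  (* Cauchy-Schwarz termwise: [N] sums to 1, and where [N y] is positive the difference of the two
     sides is [(T y - s * N y) ^+ 2 / N y]. *)
  have -> : s ^+ 2 = \sum_y (2 * s * T y - s ^+ 2 * N y).
    by rewrite sumrB -!mulr_sumr -sT sN -/s; ring.
  apply: ler_sum => y _.
  have [N0|N0] := eqVneq (N y) 0.
    have -> : T y = 0 by apply/eqP; rewrite eq_le T0 andbT -N0.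
    by rewrite N0 expr0n /= !(mulr0, mul0r) subr0.
  have Np : 0 < N y by rewrite lt0r N0 (le_trans (T0 y)).
  rewrite ler_pdivlMr // -subr_ge0.
  have -> : T y ^+ 2 - (2 * s * T y - s ^+ 2 * N y) * N y = (T y - s * N y) ^+ 2 by ring.
  exact: sqr_ge0.
apply: le_trans CS _.
have -> : \sum_y T y ^+ 2 / N y =
    \sum_w \sum_w' (if x w' == x w then g w * g w' / N (x w) else 0).
  rewrite [RHS](partition_big x xpredT) //=; apply: eq_bigr => y _.
  rewrite expr2 -mulrA {1}/T mulr_suml; apply: eq_bigr => w /eqP xw.
  by rewrite -big_mkcond /= xw -!mulr_suml -mulr_sumr -/(T y) mulrA.
rewrite /winp sum_ffun_pair; apply: ler_sum => w _; apply: ler_sum => w' _.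
case: eqP => [xw|_]; last first.
  apply: prodr_ge0 => j _; rewrite mulr_ge0 //.
  by have [+ _] := square_dist i S dG; apply.
rewrite /g NE -big_split /= -prodf_div; apply: ler_prod => j _.
have xj : ask G (w' j) i = ask G (w j) i.
  by move/ffunP/(_ j): xw; rewrite !xE !ffunE.
rewrite !ffunE /= -/(x w) xE ffunE xj eqxx.
set m := marg _ _.
have m0 : 0 <= m by rewrite /m marg_ge0.
apply/andP; split; first by rewrite divr_ge0 ?mulr_ge0.
have [aw|] := boolP (acc G (w j) _); last first.
  by rewrite mulr0 !mul0r mulr_ge0 // divr_ge0 ?mulr_ge0.
have [aw'|] := boolP (acc G (w' j) _); last first.
  by rewrite !mulr0 mul0r mulr_ge0 // divr_ge0 ?mulr_ge0.
rewrite !mulr1; case: existsP => [_|[]]; first by rewrite mulr1.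
(* The replies of the two original runs witness acceptance: each player's reply in the square is the
   one given in the run that supplied the questions. *)
exists (reply al (asks w) j); apply/existsP; exists (reply al (asks w') j).
rewrite aw aw' /=; apply/andP; split.
  by rewrite !ffunE; move: xw; rewrite /x /asks !ffunE => ->.
apply/eqP/ffunP => p; rewrite !ffunE.
case: ifP => pS; congr (al p _ j); apply/ffunP => k; by rewrite !ffunE /= pS.
Qed.

End VGames.

Arguments wt {R P X A} G o : rename.
Arguments ask {R P X A} G o : rename.
Arguments acc {R P X A} G o a : rename.

(** * Question sets closed under mixing *)

Definition apply_strat {P : finType} {X A : P -> finType}
    (be : {dffun forall p, {ffun X p -> A p}}) (z : {dffun forall p, X p}) :
    {dffun forall p, A p} :=
  [ffun p => be p (z p)].

Section Boxes.
Variables (P : finType) (X A : P -> finType).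

Let tupX := {dffun forall p, X p}.
Let tupA := {dffun forall p, A p}.
Let strat := {dffun forall p, {ffun X p -> A p}}.
Implicit Types (T : {set tupX}) (q : tupX) (S : {set P}).

Definition mix_closed T := forall i S q q',
  q \in T -> q' \in T -> q i = q' i -> mix S q q' \in T.

(** The whole box spanned by [q] and [q'] lies in [T]. For closed [T] and at least three players
    this is an equivalence relation on [T], and its classes are the boxes sought. *)
Definition linked T q q' := [forall S : {set P}, mix S q q' \in T].

Definition component T q := [set q' in T | linked T q q'].

Lemma mixC S q q' : mix S q q' = mix (~: S) q' q.
Proof. by apply/ffunP => p; rewrite !ffunE inE; case: (p \in S). Qed.

Lemma linked_sym T q q' : linked T q q' -> linked T q' q.
Proof. by move=> /forallP l; apply/forallP => S; rewrite mixC. Qed.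

Variable T : {set tupX}.
Hypotheses (T_closed : mix_closed T) (P_gt2 : (2 < #|P|)%N).

Lemma third_player (p p' : P) : exists2 p'', p'' != p & p'' != p'.
Proof.
have /subsetPn[p'' _] : ~~ ([set: P] \subset [set p; p']).
  apply/negP => /subset_leq_card; rewrite cardsT leqNgt => /negP[].
  by apply: leq_ltn_trans P_gt2; rewrite cards2; case: (p != p').
by rewrite !inE negb_or => /andP[]; exists p''.
Qed.

(** Mixing with [r] along [p] changes [q] at [p'] only. The result shares [p'] with [q'], which
    gives all mixtures taking [p'] from [q']; exchanging the roles gives those taking [p] from
    [q]. *)
Lemma linked_half q q' r p p' : q \in T -> q' \in T -> r \in T ->
  p != p' -> r p = q p -> r p' = q' p' ->
  forall S, (p' \notin S) || (p \in S) -> mix S q q' \in T.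
Proof.
have half q1 q2 p1 p2 : q1 \in T -> q2 \in T -> r \in T -> p1 != p2 ->
    r p1 = q1 p1 -> r p2 = q2 p2 ->
    forall S, p2 \notin S -> mix S q1 q2 \in T.
  move=> q1T q2T rT p12 rp1 rp2 S p2S.
  have uT : mix (~: [set p2]) q1 r \in T by apply: (T_closed (i := p1)).
  have -> : mix S q1 q2 = mix S (mix (~: [set p2]) q1 r) q2.
    apply/ffunP => x; rewrite !ffunE !inE; case: ifP => // xS.
    by case: eqP xS => //= ->; rewrite (negbTE p2S).
  by apply: (T_closed (i := p2)) => //; rewrite !ffunE !inE eqxx.
move=> qT q'T rT pp' rp rp' S /orP[p'S|pS]; first exact: (half q q' p p').
by rewrite mixC; apply: (half q' q p' p); rewrite // 1?eq_sym // inE negbK.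
Qed.

(* The link [r] handles the mixtures that agree with it at [p] or [p']; the remaining
   ones are reached through a third player. *)
Lemma linked_of q q' r p p' : q \in T -> q' \in T -> r \in T ->
  p != p' -> r p = q p -> r p' = q' p' -> linked T q q'.
Proof.
move=> qT q'T rT pp' rp rp'; apply/forallP => S.
have half := linked_half qT q'T rT pp' rp rp'.
have [|] := boolP ((p' \notin S) || (p \in S)); first exact: half.
rewrite negb_or negbK => /andP[p'S pS].
have [t tp tp'] := third_player p p'.
have [tS|tS] := boolP (t \in S).
  have uT : mix [set t] q q' \in T by rewrite half // inE eq_sym tp'.
  by apply: (linked_half qT q'T uT tp'); rewrite ?tS ?orbT // !ffunE !inE ?eqxx //
     eq_sym (negbTE tp').
have uT : mix [set p] q q' \in T by rewrite half // !inE eqxx orbT.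
by apply: (@linked_half _ _ _ p t qT q'T uT); rewrite ?tS 1?eq_sym // !ffunE !inE ?eqxx //
   (negbTE tp).
Qed.

Lemma linked_refl q : q \in T -> linked T q q.
Proof. by move=> qT; apply/forallP => S; rewrite mix_id. Qed.

Lemma linked_trans q q' q'' : q \in T -> q' \in T -> q'' \in T ->
  linked T q q' -> linked T q' q'' -> linked T q q''.
Proof.
move=> qT q'T q''T /forallP l /forallP l'.
have /card_gt0P[p _] : (0 < #|P|)%N by apply: ltn_trans P_gt2.
have [p' p'p _] := third_player p p; have [t tp tp'] := third_player p p'.
(* This tuple takes [p] from [q], [p'] from [q''] and the rest from [q']; its two halves agree at
   the third player [t]. *)
have rT : mix [set p] (mix [set p] q q') (mix (~: [set p']) q' q'') \in T.
  by apply: (T_closed (i := t)) => //; rewrite !ffunE !inE (negbTE tp) tp'.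
by apply: (linked_of qT q''T rT (p := p) (p' := p')); rewrite 1?eq_sym //
  !ffunE !inE ?eqxx // (negbTE p'p).
Qed.

Lemma linked_component q q' : q \in T -> q' \in T -> linked T q q' ->
  component T q = component T q'.
Proof.
move=> qT q'T l; apply/setP => r; rewrite !inE.
case rT : (r \in T) => //=; apply/idP/idP => lr.
  by apply: (linked_trans (q' := q)) => //; apply: linked_sym.
by apply: (linked_trans (q' := q')).
Qed.

Lemma component_box q (t : tupX) : q \in T ->
  (forall p, exists2 q', q' \in component T q & q' p = t p) -> t \in component T q.
Proof.
move=> qT tq.
(* The coordinates of [t] are inserted one player at a time, each time by mixing two linked
   tuples. *)
have [r rC rt] : exists2 r, r \in component T q & forall p, p \in enum P -> r p = t p.
  elim: (enum P) => [|p s [r rC rt]].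
    by exists q => //; rewrite inE qT linked_refl.
  have [q' q'C q'p] := tq p.
  move: rC q'C; rewrite !inE => /andP[rT lr] /andP[q'T lq'].
  have lq'r : linked T q' r.
    by apply: (linked_trans (q' := q)) => //; apply: linked_sym.
  have uT : mix [set p] q' r \in T by have /forallP := lq'r; apply.
  exists (mix [set p] q' r) => [|p']; last first.
    by rewrite ffunE !inE; case: eqP => [->|_] //= /rt.
  rewrite inE uT; apply: (linked_trans (q' := r)) => //.
  apply/forallP => S; have /forallP/(_ (~: (S :|: ~: [set p]))) := lq'r.
  rewrite -mixC; congr (_ \in T); apply/ffunP => x; rewrite !ffunE !inE.
  by case: (x \in S) => //=; case: (x == p).
by have -> : t = r by apply/ffunP => p; rewrite rt ?mem_enum.
Qed.

(* If every component had a perfect strategy, players could locate the component from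
   their own question alone, and glue these strategies together. *)
Lemma imperfect_box (good : tupX -> tupA -> bool) (q0 : tupX) : q0 \in T ->
  (forall be : strat, exists2 z, z \in T & ~~ good z (apply_strat be z)) ->
  exists B : forall p, {set X p},
    [/\ setXn B \subset T, setXn B != set0 &
        forall be : strat, exists2 z, z \in setXn B & ~~ good z (apply_strat be z)].
Proof.
move=> q0T imp.
pose perfect (C : {set tupX}) (be : strat) := [forall z in C, good z (apply_strat be z)].
have [/existsP[q /andP[qT /existsPn nq]]|] :=
    boolP [exists q : tupX, (q \in T) && ~~ [exists be, perfect (component T q) be]].
  pose B p := [set x | [exists q' in component T q, q' p == x]].
  have BE : setXn B = component T q.
    apply/setP => z; apply/setXnP/idP => [zB|zC p].
      apply: component_box => // p; have := zB p; rewrite inE.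
      by move=> /exists_inP[q' q'C /eqP]; exists q'.
    by rewrite inE; apply/exists_inP; exists z.
  exists B; rewrite BE; split.
  - by apply/subsetP => z; rewrite inE => /andP[].
  - by apply/set0Pn; exists q; rewrite inE qT linked_refl.
  - by move=> be; have := nq be; rewrite negb_forall_in => /exists_inP[z]; exists z.
move=> /existsPn all_perf.
have perf q : q \in T -> exists be, perfect (component T q) be.
  by move=> qT; have := all_perf q; rewrite qT negbK => /existsP.
have [be0 _] := perf _ q0T.
pose F C := odflt be0 [pick be | perfect C be].
pose rep p x := odflt q0 [pick q in T | q p == x].
pose be : strat := [ffun p => [ffun x => F (component T (rep p x)) p x]].
have [z zT /negP[]] := imp be.
have -> : apply_strat be z = apply_strat (F (component T z)) z.
  apply/ffunP => p; rewrite !ffunE; congr (F _ p _).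
  rewrite /rep; case: pickP => [q /andP[qT /eqP qz] /=|/(_ z)]; last by rewrite zT eqxx.
  apply: linked_component => //; apply/forallP => S; exact: (T_closed (i := p)).
rewrite /F; case: pickP => [be' /forall_inP|none] /=.
  by apply; rewrite inE zT linked_refl.
by have [be'] := perf _ zT; rewrite none.
Qed.

End Boxes.

(** * Uniform questions in a box *)

(** With [m %/ L] iterations, [K ^+ t] costs at most half of the exponent [d * m], while
    [(1 - e) ^+ t] still decays exponentially in [m]. The bound [1 - e] serves small positive
    [m]. *)
Lemma decay_rate (R : realType) (e d K : R) : 0 < e -> e <= 1 -> 0 < d -> 1 <= K ->
  exists2 c : R, 0 < c & forall (m : nat) (x : R),
    (forall t : nat, x <= (1 - e) ^+ t + K ^+ t * expR (- (d * m%:R))) ->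
    ((0 < m)%N -> x <= 1 - e) -> x <= 1 -> x <= expR (- (c * m%:R)).
Proof.
move=> e0 e1 d0 K1.
have [L L_gt0 KL] : exists2 L : nat, (0 < L)%N & K <= d * L%:R / 2.
  exists (Num.truncn (2 * K / d)).+1 => //.
  have := truncnS_gt (2 * K / d); move: (Num.truncn (2 * K / d)).+1%:R => l.
  by rewrite ltr_pdivrMr // => h; lra.
have L0 : 0 < L%:R :> R by rewrite ltr0n.
pose c0 := Num.min (e / L%:R) (d / 2).
have c00 : 0 < c0 by rewrite lt_min !divr_gt0.
have c0L : c0 * L%:R <= e by rewrite -ler_pdivlMr // ge_min lexx.
have c0d : c0 <= d / 2 by rewrite ge_min lexx orbT.
(* Each summand is at most [expR (1 - c0 * m)]. The resulting constant is absorbed when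
   [m > 4 / c0]; for smaller [m] the claimed exponent is at most [e]. *)
exists (e * c0 / 4) => [|m x xt x1 x_le1]; first by rewrite divr_gt0 ?mulr_gt0.
have [->|m0] := posnP m; first by rewrite mulr0 oppr0 expR0.
have [m_small|m_big] := lerP m%:R (4 / c0).
  apply: le_trans (x1 m0) _; apply: le_trans (expR_ge1Dx _) _.
  rewrite ler_expR lerN2; move: m_small; rewrite ler_pdivlMr // => m_small.
  have -> : e * c0 / 4 * m%:R = e * (m%:R * c0 / 4) by field.
  by rewrite ler_piMr ?(ltW e0) //; lra.
pose t := (m %/ L)%N.
have tm : t%:R * L%:R <= m%:R :> R by rewrite -natrM ler_nat leq_divM.
have mt : m%:R <= (t%:R + 1) * L%:R :> R.
  by rewrite natr1 -natrM ler_nat ltnW // ltn_ceil.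
have first_le : (1 - e) ^+ t <= expR (1 - c0 * m%:R).
  apply: (@le_trans _ _ (expR (- e) ^+ t)).
    by rewrite lerXn2r ?nnegrE ?expR_ge0 ?subr_ge0 // expR_ge1Dx.
  rewrite -expRM_natl ler_expR.
  have : c0 * m%:R <= c0 * L%:R * (t%:R + 1) by rewrite -mulrA ler_pM2l // (mulrC L%:R).
  have : c0 * L%:R * (t%:R + 1) <= e * (t%:R + 1) by rewrite ler_wpM2r // addr_ge0.
  lra.
have second_le : K ^+ t * expR (- (d * m%:R)) <= expR (1 - c0 * m%:R).
  apply: (@le_trans _ _ (expR (d * L%:R / 2) ^+ t * expR (- (d * m%:R)))).
    rewrite ler_wpM2r ?expR_ge0 // lerXn2r ?nnegrE ?expR_ge0 ?(le_trans ler01) //.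
    by apply: (le_trans KL); apply: le_trans (expR_ge1Dx _); lra.
  rewrite -expRM_natl -expRD ler_expR.
  have : d * (t%:R * L%:R) <= d * m%:R by rewrite ler_pM2l.
  have : c0 * m%:R <= d / 2 * m%:R by rewrite ler_wpM2r.
  lra.
have two : 2 <= expR 1 :> R by rewrite (le_trans _ (expR_ge1Dx _)).
apply: (@le_trans _ _ (expR 1 * expR (1 - c0 * m%:R))).
  apply: (le_trans (xt t)); apply: (@le_trans _ _ (2 * expR (1 - c0 * m%:R))); first by lra.
  by rewrite ler_wpM2r ?expR_ge0.
rewrite -expRD ler_expR.
move: m_big; rewrite ltr_pdivrMr // => m_big.
have : e * (m%:R * c0) <= 1 * (m%:R * c0) by rewrite ler_wpM2r // mulr_ge0 // ltW.
lra.
Qed.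

Section FreeGame.
Variables (R : realType) (P : finType) (X A : P -> finType).

Let tupX := {dffun forall p, X p}.
Let tupA := {dffun forall p, A p}.

(** * Proportions of question tuples in a dense set *)

Section Dense.
Variables (n : nat) (B : {set tupX}).

Let seqX := {dffun forall p, {ffun 'I_n -> X p}}.
Let b : R := #|B|%:R.

Definition dens : R := (1 - expR (- 1)) / #|B|%:R / 2.

Lemma dens_gt0 : B != set0 -> 0 < dens.
Proof.
move=> B0; rewrite /dens !divr_gt0 ?ltr0n ?card_gt0 //.
by rewrite subr_gt0 expR_lt1 ltrN10.
Qed.

(* If [z_j] avoids a value [ze_j] most of the time for all [j] in [J], the number of
   [j] with [z_j = ze_j] is atypically small, so [D] is exponentially small. *)
Lemma dense_coordinate (J : {set 'I_n}) (D : {set seqX}) : B != set0 ->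
  (forall s j, s \in D -> row s j \in B) ->
  (forall j, j \in J -> exists2 ze, ze \in B &
     #|[set s in D | row s j == ze]|%:R <= dens * #|D|%:R) ->
  #|D|%:R <= b ^+ n * expR (- (dens * #|J|%:R)).
Proof.
move=> B0 DB sparse.
have bp : 0 < b by rewrite ltr0n card_gt0.
have [z0 z0B] : exists z0, z0 \in B by apply/set0Pn.
have [ze zeP] : exists ze : 'I_n -> tupX, forall j, ze j \in B /\
    (j \in J -> #|[set s in D | row s j == ze j]|%:R <= dens * #|D|%:R).
  apply: (@fin_all_exists _ (fun _ => tupX) (fun j z => z \in B /\
    (j \in J -> #|[set s in D | row s j == z]|%:R <= dens * #|D|%:R))) => j.
  have [jJ|jJ] := boolP (j \in J); last by exists z0.
  by have [z zB zs] := sparse j jJ; exists z.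
pose e j (x : tupX) : R := if (j \in J) && (x == ze j) then 1 else 0.
pose y s := \sum_j e j (row s j).
have sum_y : \sum_(s in D) y s <= dens * #|J|%:R * #|D|%:R.
  rewrite exchange_big /= (bigID [in J]) /= [X in _ + X]big1 ?addr0; last first.
    by move=> j /negbTE jJ; apply: big1 => s _; rewrite /e jJ.
  rewrite mulrAC mulr_natr -sumr_const; apply: ler_sum => j jJ.
  have [_ /(_ jJ)] := zeP j; apply: le_trans.
  rewrite -sum1_card natr_sum [leRHS](eq_bigl (fun s => (s \in D) && (row s j == ze j))).
    by rewrite big_mkcondr /=; apply: ler_sum => s _; rewrite /e jJ.
  by move=> s; rewrite inE.
set x0 := dens * #|J|%:R in sum_y *.
(* Jensen's inequality via the tangent at [x0], which bounds the average of [y] over [D]. *)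
have low : #|D|%:R * expR (- x0) <= \sum_(s in D) expR (- y s).
  apply: (@le_trans _ _ (\sum_(s in D) expR (- x0) * (1 + (x0 - y s)))).
    rewrite -mulr_sumr mulrC ler_wpM2l ?expR_ge0 //.
    rewrite (eq_bigr (fun s => (1 + x0) - y s)); last by move=> s _; ring.
    rewrite sumrB sumr_const -(mulr_natl (1 + x0)); nra.
  apply: ler_sum => s _.
  rewrite [leRHS](_ : _ = expR (- x0 + (x0 - y s))); last by congr expR; ring.
  by rewrite expRD; apply: ler_wpM2l; [exact: expR_ge0 | exact: expR_ge1Dx].
(* Over all sequences in [B] the rounds are independent, and each round of [J] contributes at most
   [expR (- (2 * dens))]: twice the exponent of the lower bound. *)
have up : \sum_(s in D) expR (- y s) <= b ^+ n * expR (- (2 * x0)).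
  pose f j (x : tupX) : R := if x \in B then expR (- e j x) else 0.
  apply: (@le_trans _ _ (\sum_(s : seqX) \prod_j f j (row s j))).
    rewrite [leRHS](bigID [in D]) /=; apply: ler_wpDr.
      by apply: sumr_ge0 => s _; apply: prodr_ge0 => j _; rewrite /f; case: ifP; rewrite ?expR_ge0.
    apply: ler_sum => s sD; rewrite /y -sumrN expR_sum.
    by apply: ler_prod => j _; rewrite expR_ge0 /f DB //= lexx.
  have -> : \sum_(s : seqX) \prod_j f j (row s j) =
      \sum_(z : {ffun 'I_n -> tupX}) \prod_j f j (z j).
    by rewrite sum_rows; apply: eq_bigr => s _; apply: eq_bigr => j _; rewrite ffunE.
  rewrite -bigA_distr_bigA /=.
  have -> : b ^+ n * expR (- (2 * x0)) =
      \prod_(j < n) (b * (if j \in J then expR (- (2 * dens)) else 1)).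
    rewrite big_split /= prodr_const card_ord -big_mkcond /= prodr_const.
    by rewrite -expRM_natl /x0; congr (_ * expR _); ring.
  apply: ler_prod => j _; apply/andP; split.
    by apply: sumr_ge0 => x _; rewrite /f; case: ifP; rewrite ?expR_ge0.
  rewrite /f -big_mkcond /=.
  have [jJ|jJ] := boolP (j \in J); last first.
    rewrite (eq_bigr (fun=> 1)) ?sumr_const ?mulr1 // => x _.
    by rewrite /e (negbTE jJ) oppr0 expR0.
  have [zB _] := zeP j.
  apply: (@le_trans _ _ (b * (1 - 2 * dens))); last first.
    by rewrite ler_pM2l // expR_ge1Dx.
  have -> : b * (1 - 2 * dens) = expR (-1) + (b - 1).
    by rewrite /dens -/b; field; rewrite gt_eqF.
  rewrite (bigD1 (ze j)) //= /e jJ eqxx lerD2l.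
  rewrite (eq_bigr (fun=> 1)); last by move=> x /andP[_ /negbTE->]; rewrite oppr0 expR0.
  have -> : b - 1 = #|[predD1 B & ze j]|%:R.
    by rewrite /b (cardD1 (ze j)) zB natrD addrAC subrr add0r.
  by rewrite sumr_const (@eq_card _ _ [predD1 B & ze j]) // => x; rewrite !inE andbC.
have := le_trans low up.
rewrite -ler_pdivlMr ?expR_gt0 // -expRN opprK -mulrA -expRD.
by have -> : - (2 * x0) + x0 = - x0 by ring.
Qed.

End Dense.

(** * Conditioning product sets on one round *)

Variables (n : nat) (B : forall p, {set X p}) (good : tupX -> tupA -> bool).
Variable al : forall p, {ffun 'I_n -> X p} -> {ffun 'I_n -> A p}.
Hypothesis B0 : setXn B != set0.
Hypothesis imperfect : forall be : {dffun forall p, {ffun X p -> A p}},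
  exists2 z, z \in setXn B & ~~ good z (apply_strat be z).

Let seqX := {dffun forall p, {ffun 'I_n -> X p}}.
Let domain := forall p, {set {ffun 'I_n -> X p}}.
Let b : R := #|setXn B|%:R.

(** A player's answer depends on that player's questions alone, so fixing the questions and answers
    of a round leaves a product set. *)
Definition slice (D : domain) (j : 'I_n) (z : tupX) (a : tupA) : domain :=
  fun p => [set u in D p | (u j == z p) && (al u j == a p)].

Definition slicex (D : domain) (j : 'I_n) (z : tupX) : domain :=
  fun p => [set u in D p | u j == z p].

Definition within (D : domain) := forall p u j, u \in D p -> u j \in B p.

(** Proportion of the losing question tuple times that of the plurality answers to it; the successor
    keeps the denominator positive. *)
Definition loss : R := dens (setXn B) / (\prod_p #|A p|).+1%:R.

Lemma in_slicex D j z s :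
  (s \in setXn (slicex D j z)) = (s \in setXn D) && (row s j == z).
Proof.
apply/setXnP/andP => [sD|[/setXnP sD /eqP<-] p]; last by rewrite inE sD ffunE /=.
split; first by apply/setXnP => p; have := sD p; rewrite inE => /andP[].
by apply/eqP/ffunP => p; have := sD p; rewrite inE ffunE => /andP[_ /eqP].
Qed.

Lemma in_slice D j z a s : (s \in setXn (slice D j z a)) =
  (s \in setXn D) && ((row s j, reply al s j) == (z, a)).
Proof.
apply/setXnP/andP => [sD|[/setXnP sD /eqP[<- <-]] p]; last by rewrite inE sD !ffunE !eqxx.
split; first by apply/setXnP => p; have := sD p; rewrite inE => /andP[].
rewrite xpair_eqE; apply/andP; split; apply/eqP/ffunP => p; have := sD p.
  by rewrite inE ffunE => /and3P[_ /eqP].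
by rewrite inE ffunE => /and3P[_ _ /eqP].
Qed.

(* On a product set the players' answers at [j] are independent given the questions at
   [j], so the plurality answers occur jointly with probability [1 / \prod_p #|A p|]. *)
Lemma losing_coordinate (J : {set 'I_n}) (D : domain) : within D ->
  b ^+ n * expR (- (dens (setXn B) * #|J|%:R)) < #|setXn D|%:R ->
  exists2 j, j \in J & loss * #|setXn D|%:R <=
    #|[set s in setXn D | ~~ good (row s j) (reply al s j)]|%:R.
Proof.
move=> DB big_D.
have rowB s j : s \in setXn D -> row s j \in setXn B.
  by move=> /setXnP sD; apply/setXnP => p; rewrite ffunE; apply: DB.
have [/existsP[j /andP[jJ /forall_inP dense]]|none] := boolP [exists j : 'I_n, (j \in J) &&
    [forall ze in setXn B, dens (setXn B) * #|setXn D|%:R <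
       #|[set s in setXn D | row s j == ze]|%:R :> R]]; last first.
  have := big_D; rewrite ltNge dense_coordinate // => j jJ.
  move/existsPn/(_ j): none; rewrite jJ /= negb_forall_in => /exists_inP[ze zeB].
  by rewrite -leNgt; exists ze.
exists j => //.
have [d /setXnP dD] : exists d, d \in setXn D.
  apply/set0Pn; rewrite -card_gt0 -(ltr0n R); apply: le_lt_trans big_D.
  by rewrite mulr_ge0 ?expR_ge0 ?exprn_ge0 ?ler0n.
pose cnt p x a := #|[set u in D p | (u j == x) && (al u j == a)]|.
(* The answer of a member [d] of [D] serves as the default that shows [A p] inhabited. *)
pose best p x := [arg max_(a > al (d p) j) cnt p x a].
pose be : {dffun forall p, {ffun X p -> A p}} := [ffun p => [ffun x => best p x]].
have [z zB bad] := imperfect be.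
have cnt_best p x : (#|[set u in D p | u j == x]| <= #|A p| * cnt p x (best p x))%N.
  rewrite -sum1_card (partition_big (fun u : {ffun 'I_n -> X p} => al u j) xpredT) //=.
  rewrite -sum_nat_const; apply: leq_sum => a _.
  apply: (@leq_trans (cnt p x a)).
    rewrite sum1_card; apply: subset_leq_card; apply/subsetP => u.
    by rewrite unfold_in /= !inE -andbA.
  by rewrite /best; case: arg_maxnP => // a' _; apply.
set losing := [set s in _ | _].
have slice_losing : setXn (slice D j z (apply_strat be z)) \subset losing.
  apply/subsetP => s; rewrite in_slice => /andP[sD /eqP[sz sa]].
  by rewrite inE sD sz sa.
have plurality : (#|setXn (slicex D j z)| <=
    \prod_p #|A p| * #|setXn (slice D j z (apply_strat be z))|)%N.
  rewrite !cardsXn -big_split /=; apply: leq_prod => p _.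
  by apply: leq_trans (cnt_best p (z p)) _; rewrite /cnt /slice !ffunE.
rewrite /loss mulrAC ler_pdivrMr ?ltr0n // -natrM.
apply: le_trans (ltW (dense z zB)) _; rewrite ler_nat.
rewrite (_ : [set s in _ | _] = setXn (slicex D j z)); last first.
  by apply/setP => s; rewrite in_slicex inE.
apply: leq_trans plurality _; rewrite mulnC leq_mul //.
exact: subset_leq_card.
Qed.

Definition winning (J : {set 'I_n}) (D : domain) : {set seqX} :=
  [set s in setXn D | [forall j in J, good (row s j) (reply al s j)]].

Definition branching : R := #|{: tupX * tupA}|.+1%:R.

Lemma loss_gt0 : 0 < loss.
Proof. by rewrite divr_gt0 ?ltr0n ?dens_gt0. Qed.

Lemma loss_le1 : loss <= 1.
Proof.
have B1 : 1 <= b by rewrite ler1n card_gt0.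
rewrite ler_pdivrMr ?ltr0n // mul1r; apply: (@le_trans _ _ 1); last by rewrite ler1n.
rewrite /dens -/b ler_pdivrMr // ler_pdivrMr ?(lt_le_trans ltr01) //.
have := expR_gt0 (-1 : R); lra.
Qed.

Lemma winning_step (J : {set 'I_n}) (D : domain) : within D ->
  b ^+ n * expR (- (dens (setXn B) * #|J|%:R)) < #|setXn D|%:R ->
  exists2 j, j \in J &
    #|[set s in setXn D | good (row s j) (reply al s j)]|%:R <=
    (1 - loss) * #|setXn D|%:R.
Proof.
move=> DB /(losing_coordinate DB)[j jJ lose]; exists j => //.
rewrite mulrBl mul1r lerBrDr; apply: le_trans (lerD (lexx _) lose) _.
rewrite -natrD ler_nat -[leqRHS](cardsID [set s | good (row s j) (reply al s j)]).
by rewrite leq_add // subset_leq_card //; apply/subsetP => s; rewrite !inE andbC.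
Qed.

(** Induction on [t]. A set below the threshold is absorbed by the second summand. Otherwise the
    winning sequences are covered by the slices with winning transcripts of one round, which fill at
    most [1 - loss] of [D]; [branching] bounds their number. *)
Lemma winning_bound (J : {set 'I_n}) (t : nat) (D : domain) : within D ->
  #|winning J D|%:R <= (1 - loss) ^+ t * #|setXn D|%:R +
    branching ^+ t * (b ^+ n * expR (- (dens (setXn B) * #|J|%:R))).
Proof.
set th := b ^+ n * _.
have th0 : 0 <= th by rewrite mulr_ge0 ?expR_ge0 ?exprn_ge0 ?ler0n.
have K1 : 1 <= branching by rewrite ler1n.
have l0 : 0 <= 1 - loss by rewrite subr_ge0 loss_le1.
have winD D' : #|winning J D'|%:R <= #|setXn D'|%:R :> R.
  by rewrite ler_nat subset_leq_card //; apply/subsetP => s; rewrite inE => /andP[].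
elim: t D => [|t IH] D DB.
  by rewrite !expr0 !mul1r (le_trans (winD D)) // lerDl.
have [small|big_D] := lerP #|setXn D|%:R th.
  apply: le_trans (winD D) _; apply: ler_wpDl.
    by rewrite mulr_ge0 ?exprn_ge0.
  by apply: (le_trans small); rewrite ler_peMl // exprn_ege1.
have [j jJ step] := winning_step DB big_D.
apply: (@le_trans _ _ (\sum_(za | good za.1 za.2) #|winning J (slice D j za.1 za.2)|%:R)).
  rewrite -natr_sum ler_nat -sum1_card.
  rewrite (partition_big (fun s : seqX => (row s j, reply al s j))
    (fun za => good za.1 za.2)) /=; last first.
    by move=> s; rewrite inE => /andP[_ /forall_inP]; apply.
  apply: leq_sum => -[z a] _; rewrite sum1_card; apply: subset_leq_card.
  apply/subsetP => s; rewrite unfold_in /= => /andP[]; rewrite inE => /andP[sD win] sza.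
  by rewrite inE in_slice sD sza win.
apply: (@le_trans _ _ (\sum_(za | good za.1 za.2)
    ((1 - loss) ^+ t * #|setXn (slice D j za.1 za.2)|%:R + branching ^+ t * th))).
  apply: ler_sum => za _; apply: IH => p u k; rewrite inE => /andP[uD _].
  exact: DB.
rewrite big_split /=; apply: lerD.
  rewrite -mulr_sumr -natr_sum exprSr -mulrA ler_wpM2l ?exprn_ge0 //.
  apply: le_trans step; rewrite ler_nat -[leqRHS]sum1_card.
  rewrite [leqRHS](partition_big (fun s : seqX => (row s j, reply al s j))
    (fun za => good za.1 za.2)) /=; last by move=> s; rewrite inE => /andP[].
  apply: leq_sum => -[z a] /= gza; rewrite sum1_card; apply: subset_leq_card.
  apply/subsetP => s; rewrite in_slice => /andP[sD sza].
  by rewrite unfold_in /= inE sD sza andbT; move/eqP: sza => [-> ->].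
rewrite exprS -mulrA sumr_const -[leLHS]mulr_natl; apply: ler_wpM2r.
  by rewrite mulr_ge0 // exprn_ge0 // (le_trans ler01).
by rewrite ler_nat (leq_trans (max_card _)).
Qed.

End FreeGame.

Lemma free_game_decay (R : realType) (P : finType) (X A : P -> finType)
    (B : forall p, {set X p})
    (good : {dffun forall p, X p} -> {dffun forall p, A p} -> bool) :
  setXn B != set0 ->
  (forall be : {dffun forall p, {ffun X p -> A p}},
     exists2 z, z \in setXn B & ~~ good z (apply_strat be z)) ->
  exists2 c : R, 0 < c & forall (n : nat) (J : {set 'I_n})
      (al : forall p, {ffun 'I_n -> X p} -> {ffun 'I_n -> A p}),
    #|[set s : {dffun forall p, {ffun 'I_n -> X p}} |
       [forall j, row s j \in setXn B] &&
       [forall j in J, good (row s j) (reply al s j)]]|%:R <=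
    expR (- (c * #|J|%:R)) * #|setXn B|%:R ^+ n.
Proof.
move=> B0 imp.
have K1 : 1 <= branching R X A by rewrite ler1n.
have [c c0 cP] :=
  decay_rate (loss_gt0 R A B0) (loss_le1 R A B0) (dens_gt0 R B0) K1.
have b0 : 0 < #|setXn B|%:R :> R by rewrite ltr0n card_gt0.
exists c => // n J al.
pose D p := [set u : {ffun 'I_n -> X p} | [forall j, u j \in B p]].
have DB : within B D by move=> p u j; rewrite inE => /forallP.
have -> : [set s : {dffun forall p, {ffun 'I_n -> X p}} |
       [forall j, row s j \in setXn B] &&
       [forall j in J, good (row s j) (reply al s j)]] = winning good al J D.
  apply/setP => s; rewrite !inE; congr andb; apply/forallP/forallP => sB.
    by move=> p; rewrite inE; apply/forallP => j; have /setXnP/(_ p) := sB j; rewrite ffunE.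
  move=> j; apply/setXnP => p; rewrite ffunE; apply: DB; exact: sB.
have cD : #|setXn D|%:R = #|setXn B|%:R ^+ n :> R.
  rewrite -natrX !cardsXn (big_morph (expn^~ n) (fun a b => expnMn a b n) (exp1n n)).
  congr (_%:R); apply: eq_bigr => p _.
  rewrite -[in RHS](card_ord n) -card_ffun_on; apply: eq_card => u.
  by rewrite inE; apply/forallP/ffun_onP.
rewrite -ler_pdivrMr ?exprn_gt0 //; apply: cP.
- move=> t; rewrite ler_pdivrMr ?exprn_gt0 //.
  apply: le_trans (winning_bound R al B0 imp J t DB) _.
  by rewrite cD [leRHS]mulrDl [X in _ <= _ + X]mulrAC mulrA.
- move=> J0; rewrite ler_pdivrMr ?exprn_gt0 // -cD.
  have [|j jJ step] := @winning_step R _ _ _ _ _ good al B0 imp J D DB.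
    rewrite cD gtr_pMr ?exprn_gt0 // expR_lt1 oppr_lt0 mulr_gt0 ?dens_gt0 //.
    by rewrite ltr0n.
  apply: le_trans step; rewrite ler_nat subset_leq_card //; apply/subsetP => s.
  by rewrite !inE => /andP[-> /forall_inP]; apply.
rewrite ler_pdivrMr ?exprn_gt0 // mul1r -cD ler_nat subset_leq_card //.
  by apply/subsetP => s; rewrite inE => /andP[].
Qed.

(** * Exponential decay when the base predicates are closed under mixing *)

Section Decay.
Variables (R : realType) (P : finType) (X A : P -> finType).

Let tupX := {dffun forall p, X p}.
Let tupA := {dffun forall p, A p}.

Definition supp (G : vgame R X A) : {set tupX} :=
  [set z | [exists o, (0 < wt G o) && (ask G o == z)]].

Definition surely (G : vgame R X A) (z : tupX) (a : tupA) : bool :=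
  [forall o, (0 < wt G o) && (ask G o == z) ==> acc G o a].

Lemma min_weight (G : vgame R X A) :
  exists2 kappa : R, 0 < kappa & forall o, 0 < wt G o -> kappa <= wt G o.
Proof.
exists (\big[Num.min/1]_(o | 0 < wt G o) wt G o); first exact: lt_bigmin.
by move=> o wo; apply: bigmin_le_cond.
Qed.

(* A fraction [kappa * #|setXn B|] of the questions is split off as uniform questions
   on the box, tested by [surely]; the other rounds are conceded to the players. *)
Lemma box_decay (G : vgame R X A) (B : forall p, {set X p}) : vdist G ->
  setXn B \subset supp G -> setXn B != set0 ->
  (forall be : {dffun forall p, {ffun X p -> A p}},
     exists2 z, z \in setXn B & ~~ surely G z (apply_strat be z)) ->
  exists2 c : R, 0 < c & forall n (al : forall p, {ffun 'I_n -> X p} -> {ffun 'I_n -> A p}),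
    winp G al <= expR (- (c * n%:R)).
Proof.
move=> [w0 w1] /subsetP BG B0 imp.
have [c c0 cP] := free_game_decay R B0 imp.
have [kappa k0 kP] := min_weight G.
pose b : R := #|setXn B|%:R.
have b0 : 0 < b by rewrite ltr0n card_gt0.
pose lam (z : tupX) := \sum_(o | ask G o == z) wt G o.
pose ind (z : tupX) : R := (z \in setXn B)%:R.
pose r z := lam z - kappa * ind z.
have sum_lam : \sum_z lam z = 1.
  by rewrite -w1 [RHS](partition_big (ask G) xpredT).
have sum_ind : \sum_z ind z = b.
  by rewrite /ind -natr_sum -big_mkcond sum1_card.
have sum_r : \sum_z r z = 1 - kappa * b.
  by rewrite sumrB -mulr_sumr sum_lam sum_ind.
have lam0 z : 0 <= lam z by apply: sumr_ge0.
have some_coin z : z \in setXn B -> exists2 o, 0 < wt G o & ask G o = z.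
  by move=> /BG; rewrite inE => /existsP[o /andP[wo /eqP oz]]; exists o.
have lam_ge o : wt G o <= lam (ask G o).
  by rewrite /lam (bigD1 o) //= lerDl sumr_ge0.
have r0 z : 0 <= r z.
  rewrite /r /ind subr_ge0; case: (boolP (z \in _)) => [/some_coin[o wo <-]|_].
    by rewrite mulr1 (le_trans (kP o wo)).
  by rewrite mulr0.
(* If a coin of positive weight asking [z] rejects [a], at least [kappa] of the weight is lost,
   which pays for the box part. *)
have dom z a : \sum_(o | ask G o == z) wt G o * (acc G o a)%:R <=
    r z + kappa * ind z * (surely G z a)%:R.
  have all_le : \sum_(o | ask G o == z) wt G o * (acc G o a)%:R <= lam z.
    by apply: ler_sum => o _; rewrite ler_piMr // lern1 leq_b1.
  have [su|] := boolP (surely G z a); first by rewrite mulr1 /r subrK.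
  rewrite mulr0 addr0 negb_forall => /existsP[o].
  rewrite negb_imply => /andP[/andP[wo oz] no].
  apply: (@le_trans _ _ (lam z - kappa)); last first.
    by rewrite lerB // ler_piMr ?(ltW k0) // lern1 leq_b1.
  rewrite lerBrDr /lam (bigD1 o) //= [leRHS](bigD1 o) //= (negbTE no) mulr0 add0r.
  rewrite addrC lerD ?kP //; apply: ler_sum => o' _.
  by rewrite ler_piMr // lern1 leq_b1.
(* In [(t, (y, u))] the flag [t] selects the question: [u] from the box or [y] from the rest. The
   weights [h] make the sum over the other component equal to [kappa * ind u] or [r y]. *)
pose U := (bool * (tupX * tupX))%type.
pose h (t : bool) y := if t then kappa * lam y else r y / b.
pose f (x : U) := if x.1 then x.2.2 else x.2.1.
pose g (x : U) (a : tupA) : R :=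
  h x.1 x.2.1 * ind x.2.2 * (x.1 ==> surely G x.2.2 a)%:R.
have gE z a : \sum_(x | f x == z) g x a = r z + kappa * ind z * (surely G z a)%:R.
  rewrite big_mkcond /= sum_pair big_bool /= addrC !sum_pair.
  congr (_ + _); rewrite /f /g /h /=.
    rewrite (bigD1 z) //= [X in _ + X]big1 ?addr0; last first.
      by move=> y /negbTE yz; apply: big1 => u _; rewrite yz.
    rewrite eqxx -mulr_suml -mulr_sumr sum_ind mulr1 divfK //.
    by rewrite gt_eqF.
  rewrite exchange_big /= (bigD1 z) //= [X in _ + X]big1 ?addr0; last first.
    by move=> y /negbTE yz; apply: big1 => u _; rewrite yz.
  by rewrite eqxx -!mulr_suml -mulr_sumr sum_lam mulr1.
(* A test round is discounted by [expR (- c)], so one round contributes [1 - kappa * b * rho] in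
   all. *)
pose rho := 1 - expR (- c).
have rho0 : 0 < rho by rewrite subr_gt0 expR_lt1 oppr_lt0.
exists (kappa * b * rho) => [|n al]; first by rewrite !mulr_gt0.
have h0 t y : 0 <= h t y.
  by case: t; rewrite /h ?divr_ge0 ?mulr_ge0 // ltW.
apply: (@le_trans _ _ (\sum_(z : {ffun 'I_n -> tupX})
    \prod_j \sum_(x | f x == z j) g x (reply al (col z) j))).
  rewrite /winp (sum_prod_push (ask G)
    (fun j o z => wt G o * (acc G o (reply al (col z) j))%:R)).
  apply: ler_sum => z _; apply: ler_prod => j _; rewrite gE dom andbT.
  by apply: sumr_ge0 => o _; rewrite mulr_ge0.
rewrite -(sum_prod_push f (fun j x z => g x (reply al (col z) j))) sum_ffun_pair.
apply: (@le_trans _ _ (\sum_(t : {ffun 'I_n -> bool}) \sum_(y : {ffun 'I_n -> tupX})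
    \prod_j (h (t j) (y j) * b * (if t j then expR (- c) else 1)))).
  apply: ler_sum => t _; rewrite sum_ffun_pair; apply: ler_sum => y _.
  rewrite sum_rows big_split /= big_split /= prodr_const card_ord.
  rewrite -mulrA [b ^+ n * _]mulrC.
  pose J := [set j | t j].
  have -> : \prod_(j < n) (if t j then expR (- c) else 1) = expR (- (c * #|J|%:R)).
    rewrite -mulNr mulrC expRM_natl -big_mkcond /= -prodr_const.
    by apply: eq_bigl => j; rewrite inE.
  (* With [t] and [y] fixed, players can fill in the questions of the untested rounds themselves, so
     this is a strategy for the box questions alone. *)
  pose al' p (v : {ffun 'I_n -> X p}) := al p [ffun j => if t j then v j else y j p].
  apply: (le_trans _ (ler_wpM2l _ (cP n J al'))); last by apply: prodr_ge0 => j _.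
  rewrite -sum1_card natr_sum mulr_sumr [leRHS]big_mkcond /=.
  apply: ler_sum => s _; rewrite inE.
  have replyE j : reply al (col [ffun k => f ([ffun j0 => (t j0,
      [ffun j1 => (y j1, [ffun j2 => row s j2] j1)] j0)] k)]) j = reply al' s j.
    apply/ffunP => p; rewrite !ffunE /al'; congr (al p _ j); apply/ffunP => k.
    by rewrite !ffunE /f /=; case: (t k); rewrite ?ffunE.
  under eq_bigr => j _ do rewrite replyE !ffunE /g /= -mulrA.
  rewrite big_split /=; case: ifP => [_|lost].
    rewrite ler_wpM2l ?prodr_ge0 // mulr1n; apply: prodr_ile1 => j _.
    by rewrite mulr_ge0 ?mulr_ile1 // /ind ?lern1 leq_b1.
  have [j bad] : exists j, ind (row s j) * (t j ==> surely G (row s j) (reply al' s j))%:R = 0.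
    move/negbT: lost; rewrite negb_and => /orP[|].
      by rewrite negb_forall => /existsP[j /negbTE jB]; exists j; rewrite /ind jB mul0r.
    rewrite negb_forall_in => /exists_inP[j]; rewrite inE => tj /negbTE no.
    by exists j; rewrite tj no mulr0.
  by rewrite [X in _ * X](bigD1 j) //= bad mul0r mulr0.
rewrite [leLHS](_ : _ = \sum_(o : {ffun 'I_n -> bool * tupX})
  \prod_j (h (o j).1 (o j).2 * b * (if (o j).1 then expR (- c) else 1))); last first.
  rewrite sum_ffun_pair; apply: eq_bigr => t _; apply: eq_bigr => y _.
  by apply: eq_bigr => j _; rewrite ffunE.
rewrite (sum_prod_cst n (fun o : bool * tupX => h o.1 o.2 * b * (if o.1 then expR (- c) else 1))).
rewrite sum_pair /=.
rewrite big_bool /= -!mulr_suml -mulr_sumr sum_lam sum_r.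
have -> : expR (- (kappa * b * rho * n%:R)) = expR (- (kappa * b * rho)) ^+ n.
  by rewrite -expRM_natl; congr expR; ring.
have kb1 : kappa * b <= 1.
  by rewrite -subr_ge0 -sum_r sumr_ge0.
apply: lerXn2r; rewrite ?nnegrE ?expR_ge0 //.
  by rewrite addr_ge0 // !mulr_ge0 ?expR_ge0 ?subr_ge0 ?invr_ge0 // ltW.
apply: le_trans (expR_ge1Dx _); rewrite /rho !mulr1 divfK ?gt_eqF //; lra.
Qed.

Variables (Q0 : {set tupX}) (pr : tupX -> tupA -> bool).
Hypothesis pr_mix : forall q b b' i (S : {set P}),
  pr q b -> pr q b' -> b i = b' i -> pr q (mix S b b').

(** The invariant of squaring: every base tuple keeps a coin of positive weight at least as strict
    as [pr]. In the square, the pair of that coin with itself serves. *)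
Definition extends_base (G : vgame R X A) := vdist G /\
  forall q, q \in Q0 -> exists2 o, 0 < wt G o &
    ask G o = q /\ forall a, acc G o a -> pr q a.

Lemma wt_square_gt0 (G : vgame R X A) i S o o' : vdist G ->
  0 < wt G o -> 0 < wt G o' -> ask G o i = ask G o' i -> 0 < wt (square i S G) (o, o').
Proof.
by move=> dG wo wo' oo'; rewrite /= oo' eqxx divr_gt0 ?mulr_gt0 ?marg_gt0.
Qed.

Lemma extends_square G i S : extends_base G -> extends_base (square i S G).
Proof.
move=> [dG diag]; split=> [|q /diag[o wo [oq oacc]]]; first exact: square_dist.
exists (o, o); first exact: wt_square_gt0.
split=> [|a /=]; first by rewrite /= mix_id.
move=> /existsP[b /existsP[b' /and4P[ob ob' /eqP bb' /eqP->]]].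
by apply: pr_mix bb'; apply: oacc.
Qed.

Lemma mix_supp_square (G : vgame R X A) i S q q' : vdist G ->
  q \in supp G -> q' \in supp G -> q i = q' i -> mix S q q' \in supp (square i S G).
Proof.
move=> dG; rewrite !inE => /existsP[o /andP[wo /eqP<-]] /existsP[o' /andP[wo' /eqP<-]] oo'.
by apply/existsP; exists (o, o'); rewrite wt_square_gt0 /=.
Qed.

(** While a mixture is missing, one squaring adds it to the support and keeps the old tuples, which
    are mixtures of themselves. The number of tuples outside the support decreases. *)
Lemma closed_iterate (G : vgame R X A) : extends_base G ->
  exists (G' : vgame R X A) (t : nat), [/\ extends_base G', mix_closed (supp G') &
    forall n (al : forall p, {ffun 'I_n -> X p} -> {ffun 'I_n -> A p}),
      winp G al ^+ (2 ^ t) <= winp G' al].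
Proof.
have [m] := ubnP (#|[set: tupX]| - #|supp G|)%N; elim: m G => // m IH G Gm eG.
have [/forallP cl|] := boolP [forall i, forall S : {set P}, forall q in supp G,
    forall q' in supp G, (q i == q' i) ==> (mix S q q' \in supp G)].
  exists G, 0%N; split=> // i S q q' qG q'G /eqP qq'.
  by have /forallP/(_ S)/forall_inP/(_ q qG)/forall_inP/(_ q' q'G)/implyP/(_ qq') := cl i.
rewrite negb_forall => /existsP[i]; rewrite negb_forall => /existsP[S].
rewrite negb_forall_in => /exists_inP[q qG].
rewrite negb_forall_in => /exists_inP[q' q'G].
rewrite negb_imply => /andP[/eqP qq' new].
have [dG _] := eG.
have grow : supp G \proper supp (square i S G).
  apply/properP; split; last first.
    by exists (mix S q q'); [exact: mix_supp_square | exact: new].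
  by apply/subsetP => z zG; rewrite -(mix_id S z); apply: mix_supp_square.
have [|G' [t [eG' clG' leG']]] := IH (square i S G) _ (extends_square i S eG).
  rewrite ltnS in Gm; apply: leq_trans Gm; apply: ltn_sub2l (proper_card grow).
  by apply: leq_trans (proper_card grow) _; rewrite subset_leq_card ?subsetT.
exists G', t.+1; split=> // n al; rewrite expnS exprM.
apply: le_trans (leG' n al); apply: lerXn2r; rewrite ?nnegrE ?exprn_even_ge0 //.
  by apply: le_trans (winp_square i S al dG); rewrite exprn_even_ge0.
exact: winp_square.
Qed.

Lemma vgame_decay (G : vgame R X A) (q0 : tupX) : (2 < #|P|)%N -> extends_base G ->
  q0 \in Q0 ->
  (forall be : {dffun forall p, {ffun X p -> A p}},
     exists2 q, q \in Q0 & ~~ pr q (apply_strat be q)) ->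
  exists2 c : R, 0 < c & forall n (al : forall p, {ffun 'I_n -> X p} -> {ffun 'I_n -> A p}),
    winp G al <= expR (- (c * n%:R)).
Proof.
move=> P2 eG q0Q imp.
have [G' [t [[dG' diag] clG' leG']]] := closed_iterate eG.
have Qsupp q : q \in Q0 -> q \in supp G'.
  by move=> /diag[o wo [oq _]]; rewrite inE; apply/existsP; exists o; rewrite wo oq eqxx.
have imp' (be : {dffun forall p, {ffun X p -> A p}}) :
    exists2 z, z \in supp G' & ~~ surely G' z (apply_strat be z).
  have [q qQ bad] := imp be; exists q; first exact: Qsupp.
  have [o wo [oq oacc]] := diag q qQ.
  rewrite negb_forall; apply/existsP; exists o; rewrite wo oq eqxx /=.
  by apply: contra bad; apply: oacc.
have [B [BG B0 impB]] := imperfect_box clG' P2 (Qsupp _ q0Q) imp'.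
have [c c0 cP] := box_decay dG' BG B0 impB.
(* The bound holds for the power [2 ^ t] of the success probability, so the rate is divided by
   it. *)
exists (c / (2 ^ t)%:R) => [|n al]; first by rewrite divr_gt0 // ltr0n expn_gt0.
rewrite leNgt; apply/negP => big.
have := le_trans (leG' n al) (cP n al); rewrite leNgt => /negP; apply.
have t0 : (0 < 2 ^ t)%N by rewrite expn_gt0.
have -> : - (c * n%:R) = (2 ^ t)%:R * - (c / (2 ^ t)%:R * n%:R).
  by field; rewrite pnatr_eq0 -lt0n.
by rewrite expRM_natl ltrXn2r ?expR_ge0 // -lt0n.
Qed.

End Decay.

(** * The referee *)

(** [None] stands for the referee and [Some i] for the original player [i]. *)
Definition option_fam (k : nat) (Y : 'I_k -> finType) (Z : finType) (p : option 'I_k) :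
  finType := if p is Some i then Y i else Z.

Definition option_tuple (k : nat) (Y : 'I_k -> finType) (Z : finType)
    (y : {dffun forall i, Y i}) (z : Z) : {dffun forall p, option_fam Y Z p} :=
  [ffun p => match p return option_fam Y Z p with Some i => y i | None => z end].

(** Labels are moved to [nat] so that their type no longer depends on [q] through [D]. *)
Lemma projection_labels (R : numDomainType) (k : nat) (G : game R k) :
  projection_game G ->
  exists lab : forall q : qtuple G, forall i, Aa G i -> nat, forall q (a : atuple G),
    V G q a <-> forall i i', lab q i (a i) = lab q i' (a i').
Proof.
move=> proj; apply: (@fin_all_exists _ (fun q => forall i, Aa G i -> nat)
  (fun q lab => forall a, V G q a <-> forall i i', lab i (a i) = lab i' (a i'))) => q.
have [D [_ [sigma Vs]]] := proj q; exists (fun i a => sigma i a : nat) => a.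
split=> [/Vs s i i'|s]; last by apply/Vs => i i' _; apply: val_inj; apply: s.
by have [->|/s->] := eqVneq i i'.
Qed.

Section ExtraPlayer.
Variables (R : realType) (k : nat) (G : game R k) (i0 : 'I_k).
Variable lab : forall q : qtuple G, forall i, Aa G i -> nat.
Hypothesis labP : forall q (a : atuple G),
  V G q a <-> forall i i', lab q (a i) = lab q (a i').

Let Xo := option_fam (Xq G) ({dffun forall i, Xq G i} : finType).
Let Ao := option_fam (Aa G) (Aa G i0).

Definition option_lab (q : qtuple G) (p : option 'I_k) : Ao p -> nat :=
  match p with Some i => @lab q i | None => @lab q i0 end.

Definition agree (q : qtuple G) (a : {dffun forall p, Ao p}) : bool :=
  [forall p, forall p', option_lab q (a p) == option_lab q (a p')].

(* A referee player receives the whole question tuple and answers for player [i0]; its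
   answer names the common label. *)
Definition refereed : vgame R Xo Ao := {|
  coin := {dffun forall i, Xq G i} : finType;
  wt := mu G;
  ask := fun q => option_tuple q q;
  acc := agree
|}.

Definition refereed_strategy (n : nat) (s : strategy (rep G n)) (p : option 'I_k) :
    {ffun 'I_n -> Xo p} -> {ffun 'I_n -> Ao p} :=
  match p return {ffun 'I_n -> Xo p} -> {ffun 'I_n -> Ao p} with
  | Some i => fun u => s i u
  | None => fun u => s i0 [ffun j => (u j : qtuple G) i0]
  end.

(** The referee copies player [i0], so the two labels agree and acceptance in each round is
    unchanged. *)
Lemma win_prob_refereed (n : nat) (s : strategy (rep G n)) :
  win_prob s = winp refereed (refereed_strategy s).
Proof.
rewrite /win_prob /winp sum_rows; apply: eq_bigr => q _ /=.
rewrite big_split /= -natr_prod.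
have -> : \prod_(j < n) mu G (coord_q q j) = \prod_(j < n) mu G ([ffun j => row q j] j).
  by apply: eq_bigr => j _; rewrite ffunE.
congr (_ * _).
set al := refereed_strategy s; set w : {ffun 'I_n -> qtuple G} := finfun _.
have -> : [forall j, V G (coord_q q j) (coord_a (answers s q) j)] =
    [forall j, agree (w j) (reply al (asks (G := refereed) w) j)].
  apply: eq_forallb => j; have -> : w j = coord_q q j by exact: ffunE.
  have rs i : reply al (asks (G := refereed) w) j (Some i) = coord_a (answers s q) j i.
    rewrite !ffunE /=; congr (s i _ j).
    by apply/ffunP => m; rewrite !ffunE.
  have rn : reply al (asks (G := refereed) w) j None = coord_a (answers s q) j i0.
    rewrite !ffunE /=; congr (s i0 _ j).
    by apply/ffunP => m; rewrite !ffunE.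
  apply/idP/forallP => [/labP l p|l].
    by apply/forallP => p'; case: p p' => [i|] [i'|] /=; rewrite ?rs ?rn; apply/eqP.
  apply/labP => i i'; have /forallP/(_ (Some i')) := l (Some i).
  by rewrite /= !rs => /eqP.
case: forallP => [all_w|not_all].
  by rewrite big1 // => j _; rewrite all_w.
have /forallPn[j bad] : ~~ [forall j, agree (w j) (reply al (asks (G := refereed) w) j)].
  exact/forallP.
by rewrite (bigD1 j) //= (negbTE bad).
Qed.

Lemma refereed_decay : (2 <= k)%N -> is_dist G -> game_val G < 1 ->
  exists2 c : R, 0 < c & forall n (al : forall p, {ffun 'I_n -> Xo p} -> {ffun 'I_n -> Ao p}),
    winp refereed al <= expR (- (c * n%:R)).
Proof.
move=> k2 [mu0 mu1] val1.
pose Q0 : {set {dffun forall p, Xo p}} :=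
  [set option_tuple q q | q : qtuple G in [set q | 0 < mu G q]].
pose pr (z : {dffun forall p, Xo p}) (a : {dffun forall p, Ao p}) := agree (z None) a.
have pr_mix q b b' i (S : {set option 'I_k}) :
    pr q b -> pr q b' -> b i = b' i -> pr q (mix S b b').
  move=> /forallP l /forallP l' bb'.
  (* All labels in [b] and [b'] equal the label of the shared answer at [i]. *)
  have to_i p : option_lab (q None) (mix S b b' p) = option_lab (q None) (b i).
    rewrite ffunE; case: ifP => _; first by have /forallP/(_ i)/eqP := l p.
    by rewrite bb'; have /forallP/(_ i)/eqP := l' p.
  by apply/forallP => p; apply/forallP => p'; rewrite !to_i.
have ext : extends_base Q0 pr refereed.
  split=> [//|z /imsetP[q]]; rewrite inE => qp ->; exists q => //.
  by split=> // a; rewrite /pr ffunE.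
have [q0 q0p] : exists q, 0 < mu G q.
  apply/existsP; apply: contraT; rewrite negb_exists => /forallP none.
  have := mu1; rewrite big1 => [/eqP|q _]; first by rewrite eq_sym oner_eq0.
  by apply/eqP; rewrite eq_le mu0 andbT leNgt none.
have q0Q : option_tuple q0 q0 \in Q0 by apply: imset_f; rewrite inE.
apply: (vgame_decay pr_mix _ ext q0Q) => [|be]; first by rewrite card_option card_ord.
have [/exists_inP[z zQ bad]|none] := boolP [exists z in Q0, ~~ pr z (apply_strat be z)].
  by exists z.
(* A strategy winning on all of [Q0], restricted to the original players, would win [G] with
   probability 1. *)
pose s : strategy G := [ffun i => be (Some i)].
suff s1 : win_prob s = 1.
  have := le_bigmax 0 (@win_prob R k G) s.
  by rewrite s1 leNgt val1.
rewrite -mu1; apply: eq_bigr => q _.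
have [qp|] := ltP 0 (mu G q); last first.
  move=> q_le0; suff -> : mu G q = 0 by rewrite mul0r.
  by apply/eqP; rewrite eq_le q_le0 mu0.
rewrite [V _ _ _](_ : _ = true) ?mulr1 //; apply/labP => i i'.
have qQ : option_tuple q q \in Q0 by apply: imset_f; rewrite inE.
move: none; rewrite negb_exists_in => /forall_inP/(_ _ qQ).
rewrite negbK /pr ffunE => /forallP/(_ (Some i))/forallP/(_ (Some i'))/eqP.
by rewrite /answers !ffunE.
Qed.

End ExtraPlayer.

Theorem theorem1p2 (R : realType) (k : nat) (G : game R k) (eps : R) :
  (2 <= k)%N -> is_dist G -> projection_game G ->
  0 < eps -> game_val G = 1 - eps ->
  exists c : R, 0 < c /\
    forall n : nat, (1 <= n)%N -> game_val (rep G n) <= expR (- (c * n%:R)).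
Proof.
move=> k2 dG proj eps0 valG.
have [lab labP] := projection_labels proj.
have i0 : 'I_k by exists 0%N; apply: leq_trans k2.
have [|c c0 cP] := refereed_decay i0 labP k2 dG.
  by rewrite valG ltrBlDr ltrDl.
exists c; split=> // n _; apply: bigmax_le => [|s _]; first exact: expR_ge0.
by rewrite (win_prob_refereed i0 labP).
Qed.
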